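(* For any plane graph $G$, any edge $e^*$ of $G$, and any assignment of lists of size $9$ to the edges of $G$, there exists a partial edge-coloring of $G$ in which every edge other than $e^*$ receives a color from its list, $e^*$ is uncolored, and no facial path of colored edges is a repetition.
   Context: A plane graph is a planar graph with a fixed embedding in the plane. A facial edge-path is a path whose edges are consecutive edges on the boundary walk of some face. An edge path $e_1,\dots,e_{2j}$ ($j\ge 1$) is a repetition if $c(e_i)=c(e_{i+j})$ for all $1\le i\le j$. A (partial) edge-coloring is a facial Thue edge-coloring if no facial path of colored edges is a repetition. *)

(* Defs.v *)
(* Plane graphs are represented combinatorially by
   rotation systems (combinatorial maps) of genus 0. *)
From mathcomp Require Import all_boot.
Set Implicit Arguments. Unset Strict Implicit. Unset Printing Implicit Defensive.

Definition map_link (D : finType) (alpha sigma : D -> D) : rel D :=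
  fun x y => [|| y == alpha x, y == sigma x | x == sigma y].

(* A plane graph given by its darts (half-edges):
   - alpha pairs the two darts of each edge (fixed-point-free involution);
   - sigma is the rotation (cyclic order of darts around each vertex);
     vertices are the sigma-orbits;
   - faces boundary walks are the orbits of phi := sigma \o alpha;
   - the graph is simple (no loops, no parallel edges);
   - the embedding is plane: Euler's formula V - E + F = 2C holds
     (equivalently every connected component has genus 0).
   Isolated vertices carry no darts; they are irrelevant for edge colorings. *)
Record plane_graph := PlaneGraph {
  dart : finType;
  alpha : dart -> dart;
  sigma : dart -> dart;
  alphaK : involutive alpha;
  alpha_nofix : forall d, alpha d != d;
  sigma_inj : injective sigma;
  no_loop : forall d, ~~ fconnect sigma d (alpha d);
  no_parallel : forall d d', fconnect sigma d d' ->
      fconnect sigma (alpha d) (alpha d') -> d = d';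
  euler : fcard sigma predT + fcard (sigma \o alpha) predT
          = #|dart| %/ 2 + 2 * n_comp (map_link alpha sigma) predT
}.
Arguments alpha : clear implicits.
Arguments sigma : clear implicits.

Definition phi (G : plane_graph) : dart G -> dart G := sigma G \o alpha G.
Arguments phi : clear implicits.

(* For the facial edge-sequence d, phi d, ..., phi^(k-1) d, the dart
   representing its i-th vertex (0 <= i <= k); the vertex is its sigma-orbit. *)
Definition vdart (G : plane_graph) (d : dart G) (k i : nat) : dart G :=
  if i < k then iter i (phi G) d else alpha G (iter k.-1 (phi G) d).

Definition facial_path (G : plane_graph) (d : dart G) (k : nat) : Prop :=
  0 < k /\ forall i j, i < j -> j <= k ->
    ~~ fconnect (sigma G) (vdart d k i) (vdart d k j).

(* partial edge-colorings are maps on darts, constant on each edge,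
   None meaning "uncolored" *)
Definition edge_coloring (G : plane_graph) (T : Type) (c : dart G -> option T) :=
  forall d, c (alpha G d) = c d.

Definition facial_thue (G : plane_graph) (T : eqType) (c : dart G -> option T) :=
  forall (d : dart G) (j : nat), 0 < j -> facial_path d (2 * j) ->
    (forall i, i < 2 * j -> c (iter i (phi G) d) != None) ->
    ~ (forall i, i < j -> c (iter i (phi G) d) = c (iter (i + j) (phi G) d)).

(* Main.v *)
(** A counting argument in the style of Rosenfeld; it colors all edges, and e*
    is uncolored only at the end.  Let [valid S] be the set of repetition-free
    colorings of an edge set S.  If e in S is consecutive, on some face, to an
    edge outside S, then 3 |valid (S - e)| <= |valid S|: of the
    9 |valid (S - e)| extensions, the bad ones contain a repetition of length 2j
    through e, and are determined by its half avoiding e; since the other half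
    can be deleted edge by edge starting from e, induction bounds the number of
    bad extensions for each such path by |valid (S - e)| / 3^(j-1).  There are
    at most 2j + 1 such paths (2j along one face of e and one along the other),
    and 3 + sum_j (2j + 1) / 3^(j-1) = 9.  For an arbitrary e in S there are at
    most 4j paths, and sum_j 4j / 3^(j-1) = 9 as well; since only finitely many
    j occur, valid S is still nonempty when valid (S - e) is. *)
Require Import Defs.
From mathcomp Require Import all_boot.
From mathcomp Require Import zify.
Set Implicit Arguments. Unset Strict Implicit. Unset Printing Implicit Defensive.

(** * Union bound and truncated geometric sums *)

Lemma card_bigcup_leq (I T : finType) (F : I -> {set T}) :
  #|\bigcup_i F i| <= \sum_i #|F i|.
Proof.
elim/big_rec2: _ => [|i n A _ leAn]; first by rewrite cards0.
by rewrite (leq_trans (leq_card_setU _ _)) // leq_add2l.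
Qed.

(* The sum of (2j + 3) / 3^j over j < N is 6 - 3 (N + 2) / 3^N. *)
Lemma geometric_sum_adjacent (b : nat -> nat) (v N : nat) :
    (forall j, 3 ^ j * b j <= v) ->
  3 ^ N * (\sum_(j < N) (2 * j + 3) * b j) + 3 * (N + 2) * v <= 6 * 3 ^ N * v.
Proof.
move=> leb; elim: N => [|N IHN]; first by rewrite big_ord0; lia.
rewrite big_ord_recr /= expnS; have := leb N.
set s := \sum_(i < N) _ in IHN *; set p := 3 ^ N in IHN *; move: (b N) => c.
by nia.
Qed.

(* The sum of (4j + 4) / 3^j over j < N is 9 - 3 (2N + 3) / 3^N. *)
Lemma geometric_sum_free (b : nat -> nat) (v N : nat) :
    (forall j, 3 ^ j * b j <= v) ->
  3 ^ N * (\sum_(j < N) (4 * j + 4) * b j) + 3 * (2 * N + 3) * v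
    <= 9 * 3 ^ N * v.
Proof.
move=> leb; elim: N => [|N IHN]; first by rewrite big_ord0; lia.
rewrite big_ord_recr /= expnS; have := leb N.
set s := \sum_(i < N) _ in IHN *; set p := 3 ^ N in IHN *; move: (b N) => c.
by nia.
Qed.

(** * Repetition-free colorings of a set of edges *)

Section Counting.

(** Here [ed] sends a dart to its edge and [a] reverses darts. A coloring picks indices, decoded by
    [col], so that every edge has exactly 9 options. *)
Context (D E : finType) (T : eqType) (ed : D -> E) (a phi : D -> D).
Context (col : D -> 'I_9 -> T).
Hypothesis edP : forall d d', ed d = ed d' -> d = d' \/ d = a d'.
Hypothesis ed_a : forall d, ed (a d) = ed d.
Hypothesis phi_inj : injective phi.
Hypothesis col_inj : forall d, injective (col d).

Implicit Types (S P : {set E}) (f g : {ffun E -> 'I_9}) (x d : D).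

Definition walk x i : E := ed (iter i phi x).

(** Only edges must be distinct, not vertices, so avoiding repetitions on trails is stronger than
    avoiding them on facial paths. *)
Definition trail S x k :=
  uniq (mkseq (walk x) k) && all [in S] (mkseq (walk x) k).

Definition repetition f x j :=
  [forall i : 'I_j, col (iter i phi x) (f (walk x i)) ==
                    col (iter (i + j) phi x) (f (walk x (i + j)))].

(** The default value off [S] represents each coloring of [S] by a single total function, so that
    cardinalities count colorings. *)
Definition supported S f := [forall e, (e \notin S) ==> (f e == ord0)].

(** The half-length is [j.+1]; bounding [j] keeps the condition boolean and loses nothing, by
    [trail_size]. *)
Definition valid S : {set {ffun E -> 'I_9}} :=
  [set f | supported S f &&
    [forall x, [forall j : 'I_#|E|,
      trail S x (2 * j.+1) ==> ~~ repetition f x j.+1]]].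

Definition restrict S f : {ffun E -> 'I_9} :=
  [ffun e => if e \in S then f e else ord0].

Definition segment x lo n : {set E} := [set:: [seq walk x i | i <- iota lo n]].

Definition borders S d := (ed (phi d) \notin S) || (ed (finv phi d) \notin S).

Lemma trailP S x k :
  reflect ((forall i j, i < k -> j < k -> walk x i = walk x j -> i = j) /\
           (forall i, i < k -> walk x i \in S)) (trail S x k).
Proof.
apply: (iffP andP) => [[/mkseq_uniqP w_inj /allP wS]|[w_inj wS]].
  split=> [i j ik jk|i ik]; first exact: w_inj.
  by apply: wS; apply/mapP; exists i; rewrite // mem_iota.
split; first by apply/mkseq_uniqP => i j; apply: w_inj.
by apply/allP => _ /mapP[i + ->]; rewrite mem_iota => /andP[_ /wS].
Qed.

Lemma trail_size S x k : trail S x k -> k <= #|E|.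
Proof.
case/andP=> /card_uniqP; rewrite size_mkseq => <- _; exact: max_card.
Qed.

Lemma segmentP x lo n e :
  reflect (exists2 i, lo <= i < lo + n & e = walk x i) (e \in segment x lo n).
Proof.
rewrite inE; apply: (iffP mapP) => -[i]; rewrite ?mem_iota => ? ->.
  by exists i.
by exists i; rewrite ?mem_iota.
Qed.

Lemma segmentSl x lo n : segment x lo n.+1 = walk x lo |: segment x lo.+1 n.
Proof. by apply/setP=> e; rewrite !inE. Qed.

Lemma segmentSr x lo n :
  segment x lo n.+1 = walk x (lo + n) |: segment x lo n.
Proof.
rewrite /segment -[in LHS](addn1 n) iotaD map_cat.
by apply/setP=> e; rewrite !inE mem_cat !inE orbC.
Qed.

Lemma supportedP S f :
  reflect (forall e, e \notin S -> f e = ord0) (supported S f).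
Proof.
apply: (iffP forallP) => H e; first by move=> eS; apply/eqP/(implyP (H e)).
by apply/implyP=> /H ->.
Qed.

Lemma supported_restrict S f : supported S (restrict S f).
Proof. by apply/supportedP => e eS; rewrite ffunE (negPf eS). Qed.

Lemma repetition_restrict S f x j :
  trail S x (2 * j) -> repetition (restrict S f) x j = repetition f x j.
Proof.
move=> /trailP[_ wS]; apply: eq_forallb => i; rewrite !ffunE.
by rewrite !wS //; have := ltn_ord i; lia.
Qed.

Lemma trailS S S' x k : S' \subset S -> trail S' x k -> trail S x k.
Proof.
by move=> /subsetP sS /trailP[w_inj wS]; apply/trailP; split=> // i /wS /sS.
Qed.

Lemma validP S f :
  reflect (supported S f /\
           forall x j, trail S x (2 * j.+1) -> ~~ repetition f x j.+1)
          (f \in valid S).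
Proof.
rewrite inE; apply: (iffP andP) => -[-> H]; split=> //.
  move=> x j tr; have jE : j < #|E| by have := trail_size tr; lia.
  by have /forallP/(_ (Ordinal jE))/implyP := forallP H x; apply.
by apply/forallP=> x; apply/forallP=> j; apply/implyP; apply: H.
Qed.

Lemma restrict_restrict S S' f :
  S' \subset S -> restrict S' (restrict S f) = restrict S' f.
Proof.
move=> /subsetP sS; apply/ffunP=> e; rewrite !ffunE.
by case: ifP => // /sS ->.
Qed.

Lemma restrict_valid S S' f :
  S' \subset S -> f \in valid S -> restrict S' f \in valid S'.
Proof.
move=> sS /validP[_ Vf]; apply/validP; split; first exact: supported_restrict.
by move=> x j tr; rewrite repetition_restrict // Vf // (trailS sS).
Qed.

(** * Extensions by one edge and the bad ones among them *)

Definition extensions S e : {set {ffun E -> 'I_9}} :=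
  [set f | supported S f & restrict (S :\ e) f \in valid (S :\ e)].

(** Gluing a valid coloring of [S :\ e] with an index for [e] is injective: the former is recovered
    by restriction, the latter by evaluation at [e]. *)
Lemma card_extensions S e :
  e \in S -> 9 * #|valid (S :\ e)| <= #|extensions S e|.
Proof.
move=> eS; pose ext (p : {ffun E -> 'I_9} * 'I_9) : {ffun E -> 'I_9} :=
  [ffun e' => if e' == e then p.2 else p.1 e'].
have ext_res g c : g \in valid (S :\ e) ->
    restrict (S :\ e) (ext (g, c)) = g.
  move=> /validP[/supportedP sg _]; apply/ffunP=> e'; rewrite !ffunE.
  case: ifPn => [|/sg //]; first by rewrite !inE => /andP[/negPf->].
have ext_inj : {in setX (valid (S :\ e)) setT &, injective ext}.
  move=> [g c] [g' c']; rewrite !inE /= !andbT => gV gV' eq_ext.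
  congr pair; last by have /ffunP/(_ e) := eq_ext; rewrite !ffunE eqxx.
  by rewrite -(ext_res g c) ?eq_ext ?ext_res ?inE.
have := card_in_imset ext_inj.
rewrite cardsX cardsT card_ord mulnC => <-.
apply/subset_leq_card/subsetP => _ /imsetP[[g c] /setXP[gV _] ->].
rewrite inE ext_res // gV andbT; apply/supportedP=> e' e'S.
rewrite ffunE; case: eqP => [e'e|_]; first by rewrite e'e eS in e'S.
by have /validP[/supportedP-> //] := gV; rewrite inE (negPf e'S) andbF.
Qed.

Definition bad S e x j : {set {ffun E -> 'I_9}} :=
  [set f in extensions S e | trail S x (2 * j.+1) && repetition f x j.+1].

(** Starting [i] steps before [d] puts [d] at position [i] of the trail. *)
Definition bad_through S e d j :=
  \bigcup_(i < 2 * j.+1) bad S e (iter i (finv phi) d) j.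

Lemma iter_finv i x : iter i (finv phi) (iter i phi x) = x.
Proof. by elim: i x => //= i IHi x; rewrite -iterS iterSr finv_f. Qed.

Lemma iter_phi_finv i x : iter i phi (iter i (finv phi) x) = x.
Proof. by elim: i x => //= i IHi x; rewrite -iterS iterSr f_finv. Qed.

(** A repetition in an extension must use the new edge, since the restriction is valid; the trail
    traverses that edge as [d] or as [a d]. *)
Lemma extensions_cover S d :
  #|extensions S (ed d)| <= #|valid S| +
    \sum_(j < #|E|)
      (#|bad_through S (ed d) d j| + #|bad_through S (ed d) (a d) j|).
Proof.
set e := ed d.
have sub : extensions S e \subset valid S :|:
    \bigcup_(j < #|E|) (bad_through S e d j :|: bad_through S e (a d) j).
  apply/subsetP=> f fX; rewrite inE; case: (boolP (f \in valid S)) => //= fV.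
  move: (fX) (fV); rewrite {1}inE => /andP[sf rf]; rewrite inE sf /=.
  case/forallPn=> x /forallPn[j]; rewrite negb_imply negbK => /andP[tr rep].
  apply/bigcupP; exists j => //.
  have [i lti wi] : exists2 i, i < 2 * j.+1 & walk x i = e.
    case: (boolP [exists i : 'I_(2 * j.+1), walk x i == e]) => [|/existsPn noe].
      by case/existsP=> i /eqP wi; exists i.
    have tr' : trail (S :\ e) x (2 * j.+1).
      have /trailP[w_inj wS] := tr; apply/trailP; split=> // i lti.
      by rewrite !inE wS // andbT (noe (Ordinal lti)).
    by case/validP: rf => _ /(_ _ _ tr'); rewrite repetition_restrict // rep.
  have xbad : f \in bad S e x j by rewrite inE fX tr rep.
  rewrite inE; apply/orP.
  by case: (edP wi) => eqi; [left|right]; apply/bigcupP;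
    exists (Ordinal lti); rewrite //= -eqi iter_finv.
apply: leq_trans (subset_leq_card sub) _.
apply: leq_trans (leq_card_setU _ _) _; rewrite leq_add2l.
apply: leq_trans (card_bigcup_leq _) _.
by apply: leq_sum => j _; apply: leq_card_setU.
Qed.

(** * Counting bad extensions by deleting half of a repetition *)

Definition grows S := forall d, ed d \in S -> borders S d ->
  3 * #|valid (S :\ ed d)| <= #|valid S|.

Lemma finv_iterS x i : finv phi (iter i.+1 phi x) = iter i phi x.
Proof. by rewrite iterS finv_f. Qed.

(* The edges of the segment are deleted one at a time, outwards from the one
   at position m, so that each of them borders an edge already deleted. *)
Lemma delete_segment S x k m lo n :
    (forall S', S' \proper S -> grows S') -> trail S x k ->
    lo <= m < lo + n.+1 -> lo + n.+1 <= k ->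
  3 ^ n * #|valid (S :\: segment x lo n.+1)| <= #|valid (S :\ walk x m)|.
Proof.
move=> growsS tr; have /trailP[w_inj wS] := tr.
(* Since [A] contains [walk x m], the set [S :\: A] is proper in [S] and [growsS] applies to it. *)
have step (A : {set E}) i y : m < k -> i < k ->
    walk x m \in A -> walk x i \notin A ->
    y = iter i phi x -> (ed (phi y) \in A) || (ed (finv phi y) \in A) ->
    3 * #|valid (S :\: (walk x i |: A))| <= #|valid (S :\: A)|.
  move=> mk ik mA iA yE adjA; rewrite setUC -setDDl.
  have SA : S :\: A \proper S.
    rewrite properE subsetDl /=; apply/subsetPn; exists (walk x m).
      exact: wS.
    by rewrite inE mA.
  have := growsS _ SA y; rewrite /borders !inE !negb_and !negbK yE.
  rewrite -yE -/(walk x i) in adjA *.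
  have <- : walk x i = ed y by rewrite /walk yE.
  apply; first by rewrite iA wS.
  by case/orP: adjA => ->; rewrite ?orbT.
elim: n lo => [|n IHn] lo lom lok.
  have -> : lo = m by lia.
  by rewrite expn0 mul1n segmentSl /segment set_nil setU0.
rewrite expnSr -mulnA.
(* The last edge to go is the right end, or the left end if position [m] is the right end. *)
have [ltm|gem] := ltnP m (lo + n.+1).
  apply: leq_trans (IHn lo _ _); [|lia|lia].
  rewrite leq_pmul2l ?expn_gt0 // segmentSr.
  apply: (step _ _ (iter (lo + n.+1) phi x)) => //; try lia.
  - by apply/segmentP; exists m => //; lia.
  - by apply/segmentP=> -[i ? /w_inj]; lia.
  - apply/orP; right; apply/segmentP; exists (lo + n); first lia.
    by rewrite addnS finv_iterS.
apply: leq_trans (IHn lo.+1 _ _); [|lia|lia].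
rewrite leq_pmul2l ?expn_gt0 // segmentSl.
apply: (step _ _ (iter lo phi x)) => //; try lia.
- by apply/segmentP; exists m => //; lia.
- by apply/segmentP=> -[i ? /w_inj]; lia.
- by apply/orP; left; apply/segmentP; exists lo.+1; first lia.
Qed.

(* A repetition is determined by either of its halves. *)
Lemma card_bad_leq_half S e x j lo :
    trail S x (2 * j.+1) -> lo = 0 \/ lo = j.+1 -> e \in segment x lo j.+1 ->
  #|bad S e x j| <= #|valid (S :\: segment x lo j.+1)|.
Proof.
move=> /trailP[w_inj wS] loE eP; set P := segment x lo j.+1 in eP *.
have res_inj : {in bad S e x j &, injective (restrict (S :\: P))}.
  move=> f g /setIdP[/setIdP[/supportedP sf _] /andP[_ /forallP rf]].
  move=> /setIdP[/setIdP[/supportedP sg _] /andP[_ /forallP rg]] eqr.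
  have eqD e' : e' \notin P -> f e' = g e'.
    move=> e'P; have [e'S|e'S] := boolP (e' \in S); last by rewrite sf ?sg.
    by have /ffunP/(_ e') := eqr; rewrite !ffunE inE e'P e'S.
  apply/ffunP=> e'; have [/segmentP[i iP ->]|/eqD//] := boolP (e' \in P).
  (* The repetition pairs a position in [P] with one outside [P], where [f] and [g] agree; [col_inj]
     turns equal colors into equal indices. *)
  case: loE => loE.
    have lti : i < j.+1 by lia.
    apply: (col_inj (d := iter i phi x)).
    rewrite (eqP (rf (Ordinal lti))) (eqP (rg (Ordinal lti))) /= eqD //.
    by apply/segmentP=> -[i' ? /w_inj]; lia.
  have lti : i - j.+1 < j.+1 by lia.
  have iE : i = i - j.+1 + j.+1 by lia.
  apply: (col_inj (d := iter i phi x)); rewrite iE.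
  rewrite -(eqP (rf (Ordinal lti))) -(eqP (rg (Ordinal lti))) /= eqD //.
  by apply/segmentP=> -[i' ? /w_inj]; lia.
rewrite -(card_in_imset res_inj); apply/subset_leq_card/subsetP.
move=> _ /imsetP[f /setIdP[/setIdP[_ fV] _] ->].
have sub : S :\: P \subset S :\ e by rewrite setDS // sub1set.
by rewrite -(restrict_restrict f sub); apply: restrict_valid sub fV.
Qed.

(** The half containing position [i] has [j] further edges, and deleting each of them gains a factor
    3. *)
Lemma card_bad S x j i :
    (forall S', S' \proper S -> grows S') -> i < 2 * j.+1 ->
  #|bad S (walk x i) x j| <= #|valid (S :\ walk x i)| %/ 3 ^ j.
Proof.
move=> growsS lti; rewrite leq_divRL ?expn_gt0 // mulnC.
have [tr|ntr] := boolP (trail S x (2 * j.+1)); last first.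
  rewrite (_ : bad _ _ _ _ = set0) ?cards0 ?muln0 //.
  by apply/setP=> f; rewrite !inE (negPf ntr) andbF.
pose lo := if i < j.+1 then 0 else j.+1.
have loi : lo <= i < lo + j.+1 by rewrite /lo; case: ltnP; lia.
have lok : lo + j.+1 <= 2 * j.+1 by rewrite /lo; case: ltnP; lia.
apply: leq_trans (delete_segment growsS tr loi lok).
rewrite leq_pmul2l ?expn_gt0 // card_bad_leq_half //.
  by rewrite /lo; case: ifP; [left|right].
by apply/segmentP; exists i.
Qed.

Lemma card_bad_finv S d d' j i :
    (forall S', S' \proper S -> grows S') -> i < 2 * j.+1 -> ed d' = ed d ->
  #|bad S (ed d) (iter i (finv phi) d') j| <= #|valid (S :\ ed d)| %/ 3 ^ j.
Proof.
move=> growsS lti <-; have := card_bad (iter i (finv phi) d') growsS lti.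
by rewrite /walk iter_phi_finv.
Qed.

Lemma card_bad_through S d d' j :
    (forall S', S' \proper S -> grows S') -> ed d' = ed d ->
  #|bad_through S (ed d) d' j| <= 2 * j.+1 * (#|valid (S :\ ed d)| %/ 3 ^ j).
Proof.
move=> growsS dd'; apply: leq_trans (card_bigcup_leq _) _.
set v := _ %/ _; have -> : 2 * j.+1 * v = \sum_(i < 2 * j.+1) v.
  by rewrite sum_nat_const card_ord.
by apply: leq_sum => i _; apply: card_bad_finv.
Qed.

(* Only trails that end at d, or only those that start at d, remain. *)
Lemma card_bad_through_borders S d j :
    (forall S', S' \proper S -> grows S') -> borders S d ->
  #|bad_through S (ed d) d j| <= #|valid (S :\ ed d)| %/ 3 ^ j.
Proof.
move=> growsS bd.
pose i0 := if ed (phi d) \notin S then (2 * j.+1).-1 else 0.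
have lti0 : i0 < 2 * j.+1 by rewrite /i0; case: ifP; lia.
apply: leq_trans (card_bad_finv growsS lti0 (erefl _)).
apply/subset_leq_card/bigcupsP => i _; apply/subsetP=> f fB.
suff -> : i0 = i by [].
move: fB; rewrite inE => /andP[_ /andP[/trailP[_ wS] _]].
have := ltn_ord i; move: bd; rewrite /borders /i0.
case: ifPn => /= [phiS _ lti|phiS finvS lti].
  have [//|neq] := eqVneq (2 * j.+1).-1 i.
  case/negP: phiS; have := wS i.+1; rewrite /walk iterS iter_phi_finv; apply; lia.
case: i wS lti => -[//|i] /= lt_i wS _; case/negP: finvS.
have := wS i; rewrite /walk -iterS iterSr iter_phi_finv; apply; lia.
Qed.

(** * Growth by induction, and existence of a coloring *)

Lemma valid_grows S : grows S.
Proof.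
have [n] := ubnP #|S|; elim: n S => // n IHn S; rewrite ltnS => leS.
have growsS S' : S' \proper S -> grows S'.
  by move=> /proper_card ltS; apply: IHn; apply: leq_trans leS.
move=> d dS bd; set v := #|valid (S :\ ed d)|.
have leb j : 3 ^ j * (v %/ 3 ^ j) <= v by rewrite mulnC leq_divM.
have := geometric_sum_adjacent #|E| leb.
(* The coefficient is 1 for the side of [d], where [borders] helps, plus [2 * j.+1] for the side of
   [a d]. The sum is at most [6 * v], which leaves [3 * v]. *)
have : 9 * v <= #|valid S| + \sum_(j < #|E|) (2 * j + 3) * (v %/ 3 ^ j).
  apply: leq_trans (card_extensions dS) _.
  apply: leq_trans (extensions_cover S d) _; rewrite leq_add2l.
  apply: leq_sum => j _.
  have := card_bad_through_borders j growsS bd.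
  have := card_bad_through j growsS (ed_a d); rewrite -/v; lia.
have : 0 < 3 ^ #|E| by rewrite expn_gt0.
set s := \sum_(j < _) _; set p := 3 ^ _; set c := #|valid S|.
by move=> p0 le1 le2; rewrite -(leq_pmul2l p0); nia.
Qed.

Lemma valid_extend S d :
  ed d \in S -> 0 < #|valid (S :\ ed d)| -> 0 < #|valid S|.
Proof.
move=> dS; set v := #|valid (S :\ ed d)| => v0.
have growsS S' : S' \proper S -> grows S' by move=> _; apply: valid_grows.
have leb j : 3 ^ j * (v %/ 3 ^ j) <= v by rewrite mulnC leq_divM.
have := geometric_sum_free #|E| leb.
have : 9 * v <= #|valid S| + \sum_(j < #|E|) (4 * j + 4) * (v %/ 3 ^ j).
  apply: leq_trans (card_extensions dS) _.
  apply: leq_trans (extensions_cover S d) _; rewrite leq_add2l.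
  apply: leq_sum => j _.
  have := card_bad_through j growsS (erefl (ed d)).
  have := card_bad_through j growsS (ed_a d); rewrite -/v; lia.
set s := \sum_(j < _) _; set p := 3 ^ _; set c := #|valid S|.
(* The sum is strictly below [9 * v], because the tail term in [geometric_sum_free] is positive when
   [v] is. *)
by nia.
Qed.

Lemma valid_gt0 S : S \subset codom ed -> 0 < #|valid S|.
Proof.
have [n] := ubnP #|S|; elim: n S => // n IHn S; rewrite ltnS => leS sS.
have [->|[e eS]] := set_0Vmem S.
  apply/card_gt0P; exists [ffun=> ord0]; apply/validP; split.
    by apply/supportedP=> e _; rewrite ffunE.
  by move=> x j /trailP[_ /(_ 0 isT)]; rewrite inE.
have /codomP[d edE] := subsetP sS e eS; rewrite edE in eS.
apply: (valid_extend eS); apply: IHn.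
  by apply: leq_trans leS; rewrite [X in _ < X](cardsD1 (ed d)) eS.
exact: subset_trans (subsetDl _ _) sS.
Qed.

Lemma nonrepetitive_coloring :
  exists f, forall x j, uniq (mkseq (walk x) (2 * j.+1)) ->
    ~~ repetition f x j.+1.
Proof.
have /card_gt0P[f /validP[_ Vf]] : 0 < #|valid [set e in codom ed]|.
  by apply: valid_gt0; apply/subsetP=> e; rewrite inE.
exists f => x j w_uniq; apply: Vf; rewrite /trail w_uniq.
by apply/allP=> _ /mapP[i _ ->]; rewrite /= inE codom_f.
Qed.

End Counting.

(** * Application to facial paths of plane graphs *)

Definition dart_edge (G : plane_graph) (d : dart G) : {set dart G} :=
  [set d; alpha G d].

Lemma dart_edge_alpha (G : plane_graph) (d : dart G) :
  dart_edge (alpha G d) = dart_edge d.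
Proof. by rewrite /dart_edge alphaK setUC. Qed.

Lemma dart_edge_eq (G : plane_graph) (d d' : dart G) :
  dart_edge d = dart_edge d' -> d = d' \/ d = alpha G d'.
Proof.
by move=> eqd; have := set21 d (alpha G d); rewrite -/(dart_edge d) eqd
  => /set2P.
Qed.

Lemma phi_injective (G : plane_graph) : injective (phi G).
Proof. exact: inj_comp (@sigma_inj G) (inv_inj (@alphaK G)). Qed.

Lemma fconnect_vdartS (G : plane_graph) (d : dart G) k i :
  i < k -> fconnect (sigma G) (alpha G (iter i (phi G) d)) (vdart d k i.+1).
Proof.
rewrite /vdart; case: (ltnP i.+1 k) => [_ _|ki ik]; first exact: fconnect1.
by rewrite (_ : k.-1 = i) ?connect0 //; lia.
Qed.

(** If edges [i < j] coincide, then vertex [i] equals vertex [j] when the darts agree, and vertex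
    [j.+1] when they are opposite. *)
Lemma facial_path_uniq (G : plane_graph) (d : dart G) k :
  facial_path d k -> uniq (mkseq (walk (@dart_edge G) (phi G) d) k).
Proof.
case=> _ fp; apply/mkseq_uniqP.
suff lt_neq i j : i < j -> j < k ->
    walk (@dart_edge G) (phi G) d i <> walk (@dart_edge G) (phi G) d j.
  move=> i j; rewrite !inE => ik jk eqw.
  by case: (ltngtP i j) => // lt; [case: (lt_neq i j)|case: (lt_neq j i)].
move=> ij jk /dart_edge_eq[eqd|eqd].
  have := fp i j ij (ltnW jk).
  by rewrite /vdart jk (ltn_trans ij jk) eqd connect0.
have := fp i j.+1 (ltnW ij) jk; have := fconnect_vdartS d jk.
by rewrite -eqd {2}/vdart (ltn_trans ij jk) => ->.
Qed.

Theorem theorem8 (G : plane_graph) (T : eqType) (L : dart G -> seq T)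
    (estar : dart G)
    (HL : forall d, size (L d) = 9 /\ uniq (L d))
    (HLe : forall d, L (alpha G d) = L d) :
  exists c : dart G -> option T,
    edge_coloring c /\
    c estar = None /\
    (forall d, d != estar -> d != alpha G estar ->
       exists2 x, c d = Some x & x \in L d) /\
    facial_thue c.
Proof.
have [x0 _] : exists x, x \in L estar.
  have [+ _] := HL estar; case: (L estar) => // x s _.
  by exists x; rewrite mem_head.
pose col (d : dart G) (i : 'I_9) := nth x0 (L d) i.
have col_inj d : injective (col d).
  move=> i i' /eqP; have [sL uL] := HL d.
  by rewrite /col nth_uniq ?sL // => /eqP/val_inj.
have [f Vf] := nonrepetitive_coloring (@dart_edge_eq G) (@dart_edge_alpha G)
  (@phi_injective G) col_inj.
(* Erasing one edge is harmless: [facial_thue] concerns only fully colored paths, on which [c]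
   agrees with the total coloring. *)
pose c d := if dart_edge d == dart_edge estar then None
            else Some (col d (f (dart_edge d))).
exists c; split; first by move=> d; rewrite /c /col dart_edge_alpha HLe.
split; first by rewrite /c eqxx.
split=> [d d1 d2|d j j0 fp colored rep].
  rewrite /c; case: eqP => [/dart_edge_eq[]/eqP|_].
  - by rewrite (negPf d1).
  - by rewrite (negPf d2).
  by exists (col d (f (dart_edge d))); rewrite // mem_nth // (HL d).1.
have jE : j = j.-1.+1 by lia.
have := Vf d j.-1; rewrite -jE => /(_ (facial_path_uniq fp))/negP; apply.
apply/forallP=> i; have lti := ltn_ord i; have := rep i lti.
have := colored i; have := colored (i + j); rewrite /c /walk.
case: ifP => [_ /(_ _)|_ _]; first by move=> /(_ ltac:(lia)).
by case: ifP => [_ /(_ ltac:(lia))|_ _ [->]].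
Qed.
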